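(* Let $A$ be a finite non-empty alphabet. If $x\in A^\omega$ is of full complexity and $\mathrm{card}(\mathrm{alph}\,x)>1$, then $x\in\mathcal P_2$.
   Context: $A^+$ is the set of non-empty finite words over $A$ and $A^\omega$ the set of one-sided infinite words over $A$; $\mathrm{alph}\,x$ is the set of letters occurring in $x$; $\mathrm{Fact}^+x$ is the set of non-empty finite factors (contiguous blocks) of $x$. The word $x\in A^\omega$ is of full complexity if $\mathrm{Fact}^+x=A^+$. A factorization of $x$ is an expression $x=U_1U_2U_3\cdots$ with all $U_i$ non-empty finite words. For $k\ge 2$, $\mathcal P_k$ is the class of infinite words $x$ over finite alphabets for which there is a map (coloring) $c:\mathrm{Fact}^+x\to C$ with $\mathrm{card}(C)=k$ such that for each factorization $x=U_1U_2U_3\cdots$ there exist $i,j\ge1$ with $c(U_i)\ne c(U_j)$. *)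

(* Defs.v *)
From mathcomp Require Import all_boot.
From mathcomp Require Import boolp classical_sets.

Set Implicit Arguments.
Unset Strict Implicit.
Unset Printing Implicit Defensive.

Local Open Scope classical_set_scope.

(* Infinite words over A are functions nat -> A, with letters indexed from 0. *)

Definition nonempty_words (A : Type) : set (seq A) := [set u | u <> [::]].

Definition Factp (A : Type) (x : nat -> A) : set (seq A) :=
  [set u | u <> [::] /\ exists i, u = mkseq (fun j => x (i + j)) (size u)].

Definition alph (A : finType) (x : nat -> A) : {set A} :=
  finset (fun a => `[< exists n, x n = a >]).

Definition full_complexity (A : Type) (x : nat -> A) : Prop :=
  Factp x = @nonempty_words A.

(* x = U 0 U 1 U 2 ... : every finite concatenation U 0 ... U (n-1) is a prefix
   of x. As the U i are non-empty, these prefixes exhaust x. *)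
Definition factorization (A : Type) (x : nat -> A) (U : nat -> seq A) : Prop :=
  (forall i, U i <> [::]) /\
  (forall n, let w := flatten (mkseq U n) in w = mkseq x (size w)).

(* The blocks of a factorization of x are factors of x, so nothing is lost in
   classP by letting factorizations range over sequences in Factp x. *)
Lemma factorization_Factp (A : Type) (x : nat -> A) (U : nat -> seq A) :
  factorization x U -> forall i, Factp x (U i).
Proof.
case=> U0 Ux i; split; first exact: U0.
set w := flatten (mkseq U i); exists (size w).
have: flatten (mkseq U i.+1) = mkseq x (size (flatten (mkseq U i.+1))) := Ux _.
rewrite mkseqS flatten_rcons -/w size_cat /mkseq iotaD map_cat.
move/(congr1 (drop (size w))); rewrite drop_size_cat // add0n.
rewrite drop_size_cat ?size_map ?size_iota // => {1}->.
by rewrite -[X in iota X]addn0 iotaDl -map_comp.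
Qed.

(* c ranges over maps from Factp x, seen as a subtype of seq A, to a set C of k
   colors. Surjectivity of c is not required. *)
Definition classP (k : nat) (A : finType) (x : nat -> A) : Prop :=
  exists (C : finType) (c : Factp x -> C),
    #|C| = k /\
    forall U : nat -> Factp x, factorization x (fun i => val (U i)) ->
      exists i j, c (U i) <> c (U j).

(* Main.v *)
Require Import Defs.
From mathcomp Require Import all_boot.
From mathcomp Require Import boolp classical_sets.

(** Order [A] totally and infinite words lexicographically. As [x] is not
    periodic, [u x <> x] for every non-empty word [u]; color [u] according to
    whether [u x < x] or [u x > x]. If [x = U_0 U_1 U_2 ...] with all
    [U_i x < x], then [x > U_0 x > U_0 U_1 x > ...], and this sequence converges
    to [x] while staying below [U_0 x < x]: contradiction. The other color is
    excluded by reversing the order. *)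

Set Implicit Arguments.
Unset Strict Implicit.
Unset Printing Implicit Defensive.

Section Prepend.
Variable A : Type.
Implicit Types (u v : seq A) (y z : nat -> A).

(** The default value of [nth] supplies the tail: it is returned exactly when [size u <= n]. *)
Definition prepend u y : nat -> A := fun n => nth (y (n - size u)) u n.

Lemma prepend_ltn u y n a : n < size u -> prepend u y n = nth a u n.
Proof. by move=> nu; exact: set_nth_default. Qed.

Lemma prependD u y n : prepend u y (size u + n) = y n.
Proof. by rewrite /prepend nth_default ?leq_addr // addKn. Qed.

Lemma prepend_cat u v y : prepend (u ++ v) y = prepend u (prepend v y).
Proof.
apply/funext => n; rewrite /prepend nth_cat size_cat subnDA.
by case: ltnP => // nu; [exact: set_nth_default | rewrite [RHS]nth_default].
Qed.

End Prepend.

Section Lexicographic.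
Variables (A : Type) (r : rel A).
Implicit Types (u : seq A) (x y z : nat -> A) (n p : nat).

(** The position [p] of the first difference is kept explicit so that it can be bounded along a
    chain of inequalities. *)
Definition lex_at p y z := (forall i, i < p -> y i = z i) /\ r (y p) (z p).

Definition lex y z := exists p, lex_at p y z.

Lemma lex_at_prepend u p y z :
  lex_at p y z -> lex_at (size u + p) (prepend u y) (prepend u z).
Proof.
move=> [eq_yz r_yz]; split=> [i|]; last by rewrite !prependD.
case: (ltnP i (size u)) => [iu _|/subnKC <-].
  by rewrite !(prepend_ltn _ (y 0)).
by rewrite ltn_add2l !prependD => /eq_yz.
Qed.

Lemma lex_at_trans p q x y z : transitive r ->
  lex_at p x y -> lex_at q y z -> lex_at (minn p q) x z.
Proof.
move=> r_trans [eq_xy r_xy] [eq_yz r_yz]; split=> [i|].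
  by rewrite leq_min => /andP[ip iq]; rewrite eq_xy ?eq_yz.
case: (ltngtP p q) => [pq|qp|pq].
- by rewrite -eq_yz.
- by rewrite eq_xy.
- by apply: r_trans r_xy _; rewrite pq.
Qed.

Lemma size_flatten_mkseq (U : nat -> seq A) n :
  (forall i, U i <> [::]) -> n <= size (flatten (mkseq U n)).
Proof.
move=> U0; elim: n => // n IHn.
rewrite mkseqS flatten_rcons size_cat -addn1 leq_add //.
by case: (U n) (U0 n).
Qed.

(** Convergence in finite form: prepending more blocks never moves the first difference with [x]
    beyond [m], its position for [U 0], yet the first [m.+1] blocks form a prefix of [x] longer than
    [m]. *)
Lemma factorization_not_all_lex x (U : nat -> seq A) :
  irreflexive r -> transitive r -> factorization x U ->
  ~ forall i, lex (prepend (U i) x) x.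
Proof.
move=> r_irr r_trans [U0 Ux] Ulex; have [m lt_m] := Ulex 0.
pose W n := flatten (mkseq U n).
have WS n : W n.+1 = W n ++ U n by rewrite /W mkseqS flatten_rcons.
have [p pm [_]] : exists2 p, p <= m & lex_at p (prepend (W m.+1) x) x.
  (* Only the number of blocks varies; the bound [m] on [p] stays fixed. *)
  elim: {2}m => [|n [p pm lt_p]]; first by exists m; rewrite ?WS.
  (* Prepending [W n.+1] to [U n.+1 x < x] gives [W n.+2 x < W n.+1 x], and [W n.+1 x < x] by
     induction. *)
  have [q lt_q] := Ulex n.+1; rewrite WS prepend_cat.
  exists (minn (size (W n.+1) + q) p); first exact: leq_trans (geq_minr _ _) pm.
  exact: lex_at_trans r_trans (lex_at_prepend _ lt_q) lt_p.
have p_lt : p < size (W m.+1).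
  by apply: leq_ltn_trans pm _; exact: (size_flatten_mkseq m.+1).
by rewrite (prepend_ltn _ (x 0)) // /W Ux nth_mkseq // r_irr.
Qed.

End Lexicographic.

Lemma lex_total (A : eqType) (r : rel A) (y z : nat -> A) :
  (forall a b, a != b -> r a b || r b a) ->
  y <> z -> lex r y z \/ lex (fun a b => r b a) y z.
Proof.
move=> r_total neq_yz.
have ex_neq : exists n, y n != z n.
  apply: contra_notP neq_yz => /forallNP eq_yz.
  by apply/funext => n; apply/eqP/negPn/negP/eq_yz.
case: (ex_minnP ex_neq) => p neq_p p_min.
have eq_p i : i < p -> y i = z i.
  by move=> ip; apply/eqP; apply: contraTT ip => /p_min; rewrite -leqNgt.
by case/orP: (r_total _ _ neq_p) => r_p; [left|right]; exists p.
Qed.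

(** If [u x = x], letters of [x] at distance [size u] agree; but [x] has the factor consisting of
    [size u] copies of [a] followed by [b]. *)
Lemma full_complexity_aperiodic (A : eqType) (x : nat -> A) (a b : A)
    (u : seq A) :
  full_complexity x -> a != b -> u <> [::] -> prepend u x <> x.
Proof.
move=> x_full ab u0 ux.
have: nonempty_words (rcons (nseq (size u) a) b) by case: (u).
rewrite -x_full => -[_ [i]]; rewrite size_rcons size_nseq => def_ab.
have nth_ab j : j <= size u -> nth a (rcons (nseq (size u) a) b) j = x (i + j).
  by move=> ju; rewrite def_ab nth_mkseq.
have u_gt0 : 0 < size u by case: (u) u0.
move: (nth_ab _ (leq0n _)) (nth_ab _ (leqnn _)).
rewrite !nth_rcons size_nseq u_gt0 ltnn eqxx nth_nseq u_gt0 addn0 => xa xb.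
by move: ab; rewrite xa xb addnC -[in x (_ + _)]ux prependD eqxx.
Qed.

Theorem corollary3p5 (A : finType) (hA : 0 < #|A|) (x : nat -> A)
    (hx : full_complexity x) (halph : 1 < #|alph x|) :
  classP 2 x.
Proof.
have [a [b [_ _ ab]]] := card_gt1P halph.
pose r : rel A := fun a b => enum_rank a < enum_rank b.
have r_irr : irreflexive r by move=> ?; exact: ltnn.
have r_trans : transitive r by move=> ? ? ?; exact: ltn_trans.
have r_total c d : c != d -> r c d || r d c.
  by rewrite -neq_ltn (inj_eq val_inj) (inj_eq enum_rank_inj).
exists bool, (fun u => `[< lex r (prepend (val u) x) x >]).
split=> [|U Ux]; first exact: card_bool.
apply: contrapT => /forallNP mono.
have {}mono i : lex r (prepend (val (U i)) x) x <->
                lex r (prepend (val (U 0)) x) x.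
  by apply: asbool_eq_equiv; apply: contrapT => neq; apply: (mono i); exists 0.
case: (pselect (lex r (prepend (val (U 0)) x) x)) => [lt0|nlt0].
  by apply: (factorization_not_all_lex r_irr r_trans Ux) => i; apply/mono.
apply: (@factorization_not_all_lex _ (fun a b => r b a) _ _ _ _ Ux) => //.
  by move=> ? ? ? /[swap]; exact: r_trans.
(* The color [false] only says that [U i x < x] fails; as [U i x <> x], totality gives
   [U i x > x]. *)
move=> i; have Ui0 : val (U i) <> [::] := Ux.1 i.
by case: (lex_total r_total (full_complexity_aperiodic hx ab Ui0)) => // /mono.
Qed.
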